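(* Let $n\ge 2$ and let $\mathcal{C}$ and $\mathcal{B}$ be maximal (by inclusion) collections of pairwise weakly separated $2$-subsets of $[1\dots n]$. Then there is a sequence of $(2,4)$-moves transforming $\mathcal{C}$ into $\mathcal{B}$.
   Context: Notation: $[1\dots n]=\{1,\dots,n\}$; $X-Y$ is set difference. For sets of integers write $X\prec Y$ if $x<y$ for all $x\in X$, $y\in Y$ (vacuously true if one is empty). Two $k$-subsets $I,J$ of $[1\dots n]$ are weakly separated if at least one of the following holds: (1) $J-I$ can be partitioned as $J'\sqcup J''$ with $J'\prec I-J\prec J''$; (2) $I-J$ can be partitioned as $I'\sqcup I''$ with $I'\prec J-I\prec I''$. (Parts may be empty.) $(2,4)$-move: let $\mathcal{C}$ be a maximal collection of pairwise weakly separated $k$-subsets of $[1\dots n]$, and suppose $I\cup\{i,s\}$, $I\cup\{s,j\}$, $I\cup\{j,t\}$, $I\cup\{i,t\}\in\mathcal{C}$ for some $i<s<j<t$ and some $I\subset[1\dots n]-\{i,j,s,t\}$ with $|I|=k-2$. Then $\mathcal{C}$ contains exactly one of $I\cup\{i,j\}$ and $I\cup\{s,t\}$, and the $(2,4)$-move replaces that set in $\mathcal{C}$ by the other one; the result is again a maximal collection of pairwise weakly separated $k$-subsets. (Here $k=2$, so $I=\emptyset$.) The sequence of moves may be empty. *)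

(* Defs.v *)
(* MathComp world. The ground set [1..n] is represented by 'I_n = {0, .., n-1},
   i.e. shifted by one; every notion below depends only on the order of the
   ground set. *)
From mathcomp Require Import all_boot.

Set Implicit Arguments.
Unset Strict Implicit.
Unset Printing Implicit Defensive.

Definition set_prec n (X Y : {set 'I_n}) : bool :=
  [forall x in X, forall y in Y, x < y].

(* [surrounds X Y]: X is a disjoint union X' + X'' with X' < Y < X''
   (parts may be empty). *)
Definition surrounds n (X Y : {set 'I_n}) : bool :=
  [exists X' : {set 'I_n}, exists X'' : {set 'I_n},
     [&& X' :|: X'' == X, [disjoint X' & X''], set_prec X' Y & set_prec Y X'']].

Definition weakly_separated n (I J : {set 'I_n}) : bool :=
  surrounds (J :\: I) (I :\: J) || surrounds (I :\: J) (J :\: I).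

(* The diagonal pairs I = J are harmless: weak separation is reflexive. *)
Definition ws_collection n (k : nat) (C : {set {set 'I_n}}) : bool :=
  [forall I in C, #|I| == k]
  && [forall I in C, forall J in C, weakly_separated I J].

Definition maximal_ws n (k : nat) (C : {set {set 'I_n}}) : bool :=
  maxset (ws_collection k) C.

(* [move24 k C D]: D results from C by one (2,4)-move.  The condition
   |I| = k - 2 is written |I| + 2 = k, so that it forces k >= 2. *)
Definition move24 n (k : nat) : rel {set {set 'I_n}} := fun C D =>
  maximal_ws k C &&
  [exists I : {set 'I_n}, exists i : 'I_n, exists s : 'I_n,
   exists j : 'I_n, exists t : 'I_n,
     [&& [&& i < s, s < j & j < t],
         [disjoint I & [set i; j; s; t]],
         #|I|.+2 == k,
         [&& I :|: [set i; s] \in C, I :|: [set s; j] \in C,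
             I :|: [set j; t] \in C & I :|: [set i; t] \in C]
       & let ij := I :|: [set i; j] in
         let st := I :|: [set s; t] in
         [&& ij \in C, st \notin C & D == st |: (C :\ ij)]
         || [&& st \in C, ij \notin C & D == ij |: (C :\ st)]]].

(* Main.v *)
(* A 2-subset {i, j} is a chord of a convex n-gon with vertices 0, .., n-1, and
   weak separation of 2-subsets means that the chords do not cross, so that a
   maximal collection is a triangulation together with the n boundary edges.  If
   some chord at 0 is missing, let a < b be consecutive neighbours of 0 with
   b > a + 1.  Then no chord of the collection crosses ab, so ab belongs to it,
   and so do ac and cb, where c is the last neighbour of a before b.  Flipping ab
   to 0c increases the degree of 0.  Hence every maximal collection is joined to
   the one in which 0 has all possible neighbours, and moves are reversible. *)
Require Import Defs.
From mathcomp Require Import all_boot.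

Set Implicit Arguments.
Unset Strict Implicit.
Unset Printing Implicit Defensive.

(** * Weak separation, elementwise *)

Lemma surroundsP n (X Y : {set 'I_n}) :
  reflect {in X, forall x : 'I_n, {in Y, forall y : 'I_n, x < y}
                               \/ {in Y, forall y : 'I_n, y < x}}
          (surrounds X Y).
Proof.
apply: (iffP existsP) => [[X' /existsP[X'' /and4P[/eqP<- _ lt1 lt2]]] x|sepX].
  case/setUP=> xX; [left | right] => y yY.
    by move/forall_inP/(_ _ xX)/forall_inP/(_ _ yY): lt1.
  by move/forall_inP/(_ _ yY)/forall_inP/(_ _ xX): lt2.
(* The lower part can be taken as large as possible; when [Y] is empty it is all of [X]. *)
pose X' := [set x in X | [forall y in Y, x < y]].
exists X'; apply/existsP; exists (X :\: X'); apply/and4P; split.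
- apply/eqP/setP => x; rewrite !inE.
  by case: (x \in X) => //=; case: [forall y in Y, _].
- rewrite -setI_eq0; apply/eqP/setP => x; rewrite !inE.
  by case: (x \in X) => //=; case: [forall y in Y, _].
- by apply/forall_inP => x; rewrite inE => /andP[].
apply/forall_inP => y yY; apply/forall_inP => x.
rewrite !inE => /andP[] + xX; rewrite xX /=.
by case: (sepX x xX) => [ltx /negP[]|ltx _]; [apply/forall_inP | apply: ltx].
Qed.

Lemma weakly_separated_sym n : symmetric (@weakly_separated n).
Proof. by move=> I J; rewrite /weakly_separated orbC. Qed.

Lemma weakly_separated_refl n : reflexive (@weakly_separated n).
Proof.
move=> I; rewrite /weakly_separated setDv; apply/orP; left.
by apply/surroundsP => x; rewrite inE.
Qed.

(** Maximality need only be tested by adding one set: any member of a larger collection is already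
    weakly separated from all of [C]. *)
Lemma maximal_wsP n k (C : {set {set 'I_n}}) :
  reflect [/\ {in C, forall I : {set 'I_n}, #|I| = k},
              {in C &, forall I J, weakly_separated I J}
            & forall J : {set 'I_n}, #|J| = k ->
                {in C, forall I, weakly_separated J I} -> J \in C]
          (maximal_ws k C).
Proof.
apply: (iffP maxsetP) => [[wsC maxC]|[cardC wsC maxC]]; last first.
  split=> [|D /andP[/forall_inP cardD /forall_inP wsD] sCD].
    apply/andP; split; apply/forall_inP => I IC; first exact/eqP/cardC.
    by apply/forall_inP => J; apply: wsC.
  apply/eqP; rewrite eqEsubset sCD andbT; apply/subsetP => J JD.
  apply: maxC => [|I /(subsetP sCD) ID]; first exact/eqP/cardD.
  by move/forall_inP: (wsD J JD); apply.
case/andP: (wsC) => /forall_inP cardC /forall_inP sepC.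
split=> [I /cardC/eqP//|I J /sepC/forall_inP|J cardJ sepJ]; first exact.
rewrite -(maxC (J |: C)) ?setU11 ?subsetUr //.
apply/andP; split; apply/forall_inP => I /setU1P[->|IC].
- exact/eqP.
- exact: cardC.
- apply/forall_inP => K /setU1P[->|/sepJ//]; exact: weakly_separated_refl.
apply/forall_inP => K /setU1P[->|KC]; first by rewrite weakly_separated_sym sepJ.
by move/forall_inP: (sepC I IC); apply.
Qed.

(** * Weak separation of pairs as non-crossing of chords *)

(* [x] is the endpoint inside and [y] the one outside, so for [a < b] the chords
   ab and xy cross iff [crosses a b x y] or [crosses a b y x]. *)
Definition crosses n (a b x y : 'I_n) : bool :=
  [&& a < x, x < b & (y < a) || (b < y)].

(** The side on which [y] lies decides which end of [ab] falls between [x] and [y]: [a] if [y < a],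
    [b] if [b < y]. *)
Lemma crosses_sym n (a b x y : 'I_n) :
  crosses a b x y -> crosses x y b a || crosses y x a b.
Proof.
rewrite /crosses => /and3P[ax xb /orP[ya|yb]]; last by rewrite xb yb ax.
by rewrite ya ax xb !orbT.
Qed.

Lemma crosses_disjoint n (a b x y : 'I_n) :
  crosses a b x y -> [disjoint [set a; b] & [set x; y]].
Proof.
case/and3P => ax xb out; have ab := ltn_trans ax xb.
rewrite disjoint_sym disjoints_subset subUset !sub1set !inE -!val_eqE /=.
rewrite (gtn_eqF ax) (ltn_eqF xb) /=; case/orP: out => h.
  by rewrite (ltn_eqF h) (ltn_eqF (ltn_trans h ab)).
by rewrite (gtn_eqF h) (gtn_eqF (ltn_trans ab h)).
Qed.

Lemma surrounds_between n (X Y : {set 'I_n}) (a x b : 'I_n) :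
  surrounds X Y -> x \in X -> a \in Y -> b \in Y -> ~~ (a < x < b).
Proof.
move=> /surroundsP sep xX aY bY; apply/negP => /andP[ax xb].
case: (sep x xX) => h; first by have := ltn_trans ax (h a aY); rewrite ltnn.
by have := ltn_trans (h b bY) xb; rewrite ltnn.
Qed.

(** Crossing chords are disjoint, so the set differences are the pairs themselves, and each pair has
    a point strictly between the two points of the other. *)
Lemma crosses_separated n (a b x y : 'I_n) :
  crosses a b x y -> ~~ weakly_separated [set a; b] [set x; y].
Proof.
move=> cr; have dis := crosses_disjoint cr.
have dis' : [disjoint [set x; y] & [set a; b]] by rewrite disjoint_sym.
rewrite /weakly_separated (setDidPl dis) (setDidPl dis'); apply/norP; split.
  apply/negP => sep; have := surrounds_between sep (set21 x y) (set21 a b) (set22 a b).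
  by case/and3P: cr => -> ->.
apply/negP => sep; case/orP: (crosses_sym cr) => /and3P[h1 h2 _].
  have := surrounds_between sep (set22 a b) (set21 x y) (set22 x y).
  by rewrite h1 h2.
have := surrounds_between sep (set21 a b) (set22 x y) (set21 x y).
by rewrite h1 h2.
Qed.

Lemma noncrossing_separated n (a b x y : 'I_n) : a < b ->
  ~~ crosses a b x y -> ~~ crosses a b y x ->
  weakly_separated [set a; b] [set x; y].
Proof.
rewrite /crosses => lt_ab ncr ncr'; apply/orP.
(* Both ends of [xy] lie on one side of [ab]. The inequalities are weak to allow shared endpoints;
   these vanish in the set differences, which makes the inequalities strict. *)
have [out|inn] : {in [set x; y], forall z : 'I_n, (z <= a) || (b <= z)}
              \/ {in [set x; y], forall z : 'I_n, a <= z <= b}.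
  have [/andP[ax xb]|xout] := boolP (a < x < b).
    right => z /set2P[] ->; first by rewrite (ltnW ax) (ltnW xb).
    by move: ncr; rewrite ax xb /= negb_or -!leqNgt.
  have [/andP[ay yb]|yout] := boolP (a < y < b).
    right => z /set2P[] ->; last by rewrite (ltnW ay) (ltnW yb).
    by move: ncr'; rewrite ay yb /= negb_or -!leqNgt.
  left=> z /set2P[] ->; first by move: xout; rewrite negb_and -!leqNgt.
  by move: yout; rewrite negb_and -!leqNgt.
- left; apply/surroundsP => z /setDP[/out + /set2P zab] => /orP[za|bz].
    left=> w /setDP[/set2P wab _].
    have lt_za : z < a.
      by rewrite ltn_neqAle za andbT; apply/eqP => /val_inj e; apply: zab; left.
    by case: wab => ->; rewrite // (ltn_trans lt_za).
  right=> w /setDP[/set2P wab _].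
  have lt_bz : b < z.
    rewrite ltn_neqAle bz andbT eq_sym; apply/eqP => /val_inj e.
    by apply: zab; right.
  by case: wab => ->; rewrite // (ltn_trans lt_ab).
right; apply/surroundsP => z /setDP[/set2P zab _].
case: zab => ->; [left | right] => w /setDP[/inn/andP[aw wb] /set2P wab].
  by rewrite ltn_neqAle aw andbT eq_sym; apply/eqP => /val_inj e; apply: wab; left.
by rewrite ltn_neqAle wb andbT; apply/eqP => /val_inj e; apply: wab; right.
Qed.

Lemma card2_ltP n (I : {set 'I_n}) :
  reflect (exists a b : 'I_n, a < b /\ I = [set a; b]) (#|I| == 2).
Proof.
apply: (iffP (cards2P I)) => [[a [b [ab ->]]]|[a [b [lt_ab ->]]]].
  move: ab; rewrite -val_eqE /= neq_ltn => /orP[lt_ab|lt_ba].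
    by exists a, b.
  by exists b, a; rewrite setUC.
by exists a, b; split; rewrite // -val_eqE /= neq_ltn lt_ab.
Qed.

(** One orientation of [crosses] suffices because the pairs are unordered: both [x y] and [y x] are
    instances. *)
Lemma maximal_ws2P n (C : {set {set 'I_n}}) :
  reflect [/\ {in C, forall I : {set 'I_n}, #|I| = 2},
              forall a b x y : 'I_n, [set a; b] \in C -> [set x; y] \in C ->
                ~~ crosses a b x y
            & forall a b : 'I_n, a < b ->
                (forall x y : 'I_n, [set x; y] \in C -> ~~ crosses a b x y) ->
                [set a; b] \in C]
          (maximal_ws 2 C).
Proof.
apply: (iffP (maximal_wsP 2 C)) => -[cardC sepC maxC]; split=> //.
- move=> a b x y abC xyC; apply/negP => /crosses_separated/negP; apply.
  exact: sepC.
- move=> a b lt_ab ncr; apply: maxC => [|I IC].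
    by apply/eqP/card2_ltP; exists a, b.
  have /eqP/card2_ltP[x [y [_ eI]]] := cardC I IC; subst I.
  by apply: noncrossing_separated; rewrite ?ncr // setUC.
- move=> I J IC JC; have /eqP/card2_ltP[a [b [lt_ab eI]]] := cardC I IC.
  have /eqP/card2_ltP[x [y [_ eJ]]] := cardC J JC; subst I J.
  by apply: noncrossing_separated; rewrite ?sepC // setUC.
move=> J /eqP/card2_ltP[a [b [lt_ab ->]]] sepJ; apply: maxC => // x y xyC.
by apply: contraL (sepJ _ xyC) => /crosses_separated.
Qed.

Lemma pair_ltK n (a b x y : 'I_n) : a < b -> x < y ->
  [set a; b] = [set x; y] -> a = x /\ b = y.
Proof.
move=> lt_ab lt_xy e; have := set21 a b; have := set22 a b; rewrite e.
case/set2P=> eb /set2P[] ea; split=> //; subst a b; rewrite ?ltnn // in lt_ab *.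
- by have := ltn_trans lt_ab lt_xy; rewrite ltnn.
- by have := ltn_trans lt_ab lt_xy; rewrite ltnn.
Qed.

(** * Flipping a diagonal of a quadrilateral *)

Section Flip.

Variables (n : nat) (C : {set {set 'I_n}}) (i s j t : 'I_n).

Definition flip : {set {set 'I_n}} := [set i; j] |: (C :\ [set s; t]).

Lemma sub_flip I : I \in C -> I != [set s; t] -> I \in flip.
Proof. by move=> IC neq; rewrite in_setU1 in_setD1 neq IC orbT. Qed.

Lemma pair_sub_flip (x y : 'I_n) :
  x \notin [set s; t] -> [set x; y] \in C -> [set x; y] \in flip.
Proof.
by move=> xN xyC; apply: sub_flip => //; apply: contraNneq xN => <-; rewrite set21.
Qed.

Hypotheses (lt_is : i < s) (lt_sj : s < j) (lt_jt : j < t).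
Hypothesis maxC : maximal_ws 2 C.
Hypotheses (isC : [set i; s] \in C) (sjC : [set s; j] \in C).
Hypotheses (jtC : [set j; t] \in C) (itC : [set i; t] \in C).

Let lt_ij : i < j := ltn_trans lt_is lt_sj.
Let lt_it : i < t := ltn_trans lt_ij lt_jt.
Let lt_st : s < t := ltn_trans lt_sj lt_jt.

(** Such a chord crosses none of the four sides, so it can leave the quadrilateral only through the
    corners [s] and [t]. *)
Lemma crosses_diagonal (x y : 'I_n) :
  [set x; y] \in C -> crosses i j x y -> x = s /\ y = t.
Proof.
have [_ ncr _] := maximal_ws2P _ maxC => xyC /and3P[ix xj out].
have yxC : [set y; x] \in C by rewrite setUC.
case: (ltngtP x s) => [xs|sx|/val_inj ex].
- case/negP: (ncr _ _ _ _ isC xyC); apply/and3P; split=> //.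
  by case/orP: out => [->//|jy]; rewrite (ltn_trans lt_sj jy) orbT.
- case/negP: (ncr _ _ _ _ sjC xyC); apply/and3P; split=> //.
  by case/orP: out => [yi|->]; rewrite ?orbT // (ltn_trans yi lt_is).
split=> //; subst x; case/orP: out => [yi|jy].
  case/negP: (ncr _ _ _ _ itC xyC).
  by rewrite /crosses lt_is lt_st yi.
case: (ltngtP y t) => [yt|ty|/val_inj//].
  by case/negP: (ncr _ _ _ _ jtC yxC); rewrite /crosses jy yt lt_sj.
by case/negP: (ncr _ _ _ _ itC xyC); rewrite /crosses lt_is lt_st ty orbT.
Qed.

Hypothesis stC : [set s; t] \in C.

Lemma flip_new : [set i; j] \notin C.
Proof.
have [_ ncr _] := maximal_ws2P _ maxC.
apply/negP => ijC; case/negP: (ncr _ _ _ _ ijC stC).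
by rewrite /crosses lt_is lt_sj lt_jt orbT.
Qed.

(** Only [st] crosses [ij] in [C], so the new collection is non-crossing. A chord that crosses
    nothing in it is [ij] if it crosses [st], and otherwise lies in [C] by maximality. *)
Lemma maximal_flip : maximal_ws 2 flip.
Proof.
have [cardC ncr fillC] := maximal_ws2P _ maxC.
have diag (a b x y : 'I_n) : [set a; b] = [set i; j] ->
    [set x; y] \in C -> [set x; y] != [set s; t] -> ~~ crosses a b x y.
  move=> eab xyC; apply: contraNN => cr; have /and3P[ax xb _] := cr.
  have [ea eb] := pair_ltK (ltn_trans ax xb) lt_ij eab; subst a b.
  by have [-> ->] := crosses_diagonal xyC cr.
apply/maximal_ws2P; split=> [I|a b x y|a b lt_ab sep].
- case/setU1P => [->|/setD1P[_]]; last exact: cardC.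
  by apply/eqP/card2_ltP; exists i, j.
- move=> /setU1P[eab|/setD1P[neq abC]] /setU1P[exy|/setD1P[neq' xyC]].
  + apply/negP => /crosses_disjoint; rewrite eab exy.
    by move/disjointFr/(_ (set21 i j)); rewrite set21.
  + exact: diag.
  + apply/negP => /crosses_sym/orP[]; apply/negP; apply: diag => //.
    * by rewrite setUC.
    * by rewrite setUC.
    by rewrite setUC.
  exact: ncr.
have iN : i \notin [set s; t].
  by rewrite !inE -!val_eqE /= (ltn_eqF lt_is) (ltn_eqF lt_it).
have jN : j \notin [set s; t].
  by rewrite !inE -!val_eqE /= (gtn_eqF lt_sj) (ltn_eqF lt_jt).
(* Each side has an end outside [{s, t}], hence survives the flip and is not crossed by [ab]. *)
have side (x y : 'I_n) : x \notin [set s; t] -> [set x; y] \in C ->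
    ~ crosses a b x y /\ ~ crosses a b y x.
  move=> xN /(pair_sub_flip xN) xyF.
  by split; apply/negP; apply: sep; rewrite // setUC.
have [_ ab_si] := side i s iN isC.
have [ab_it ab_ti] := side i t iN itC.
have [_ ab_sj] : ~ crosses a b j s /\ ~ crosses a b s j.
  by apply: side; rewrite // setUC.
have [ab_jt _] := side j t jN jtC.
have [/and3P[as_ sb out]|nst] := boolP (crosses a b s t).
  have bt : b < t.
    by case/orP: out => // ta; have := ltn_trans ta (ltn_trans as_ lt_st); rewrite ltnn.
  have -> : a = i.
    case: (ltngtP a i) => [ai|ia|/val_inj//].
      by case: ab_it; apply/and3P; rewrite ai bt orbT (ltn_trans lt_is sb).
    by case: ab_si; apply/and3P; rewrite as_ sb ia.
  have -> : b = j.
    case: (ltngtP b j) => [bj|jb|/val_inj//].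
      by case: ab_sj; apply/and3P; rewrite as_ sb bj orbT.
    by case: ab_jt; apply/and3P; rewrite jb bt orbT (ltn_trans as_ lt_sj).
  by rewrite setU11.
(* This orientation is impossible: [ab] would separate [t] from [i] and so cross the side [it]. *)
have [/and3P[at_ tb out]|nts] := boolP (crosses a b t s).
  have sa : s < a.
    case/orP: out => // bs; have := ltn_trans bs (ltn_trans lt_st tb).
    by rewrite ltnn.
  by case: ab_ti; apply/and3P; rewrite at_ tb (ltn_trans lt_is sa).
apply: sub_flip.
  apply: fillC => // x y xyC.
  have [e|neq] := eqVneq [set x; y] [set s; t]; last exact/sep/sub_flip.
  case: (ltngtP x y) => [xy|yx|/val_inj <-].
  - by have [-> ->] := pair_ltK xy lt_st e.
  - by rewrite setUC in e; have [-> ->] := pair_ltK yx lt_st e.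
  by apply/negP => /and3P[ax xb /orP[]]; rewrite ltnNge ltnW.
(* The removed diagonal [st] is excluded because it crosses [ij]. *)
apply/negP => /eqP eab.
have [ea eb] := pair_ltK lt_ab lt_st eab; subst a b.
have jiF : [set j; i] \in flip by rewrite setUC setU11.
by case/negP: (sep j i jiF); rewrite /crosses lt_sj lt_jt lt_is.
Qed.

(** The common part of a move is empty since [k = 2]. *)
Let square :
  [&& [&& i < s, s < j & j < t], [disjoint set0 & [set i; j; s; t]],
      #|(set0 : {set 'I_n})|.+2 == 2
    & [&& [set i; s] \in C, [set s; j] \in C, [set j; t] \in C & [set i; t] \in C]].
Proof. by rewrite lt_is lt_sj lt_jt isC sjC jtC itC cards0 -setI_eq0 set0I eqxx. Qed.

Lemma move24_flip : move24 2 C flip.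
Proof.
rewrite /move24 maxC; apply/existsP; exists set0; apply/existsP; exists i.
apply/existsP; exists s; apply/existsP; exists j; apply/existsP; exists t.
case/and4P: square => -> -> -> /=; rewrite !set0U => ->.
by rewrite stC flip_new eqxx orbT.
Qed.

Lemma move24_unflip : move24 2 flip C.
Proof.
have iN : i \notin [set s; t].
  by rewrite !inE -!val_eqE /= (ltn_eqF lt_is) (ltn_eqF lt_it).
have jN : j \notin [set s; t].
  by rewrite !inE -!val_eqE /= (gtn_eqF lt_sj) (ltn_eqF lt_jt).
have sjF : [set s; j] \in flip by rewrite setUC pair_sub_flip // setUC.
rewrite /move24 maximal_flip; apply/existsP; exists set0; apply/existsP; exists i.
apply/existsP; exists s; apply/existsP; exists j; apply/existsP; exists t.
case/and4P: square => -> -> -> /= _; rewrite !set0U sjF.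
rewrite (pair_sub_flip iN isC) (pair_sub_flip jN jtC) (pair_sub_flip iN itC) /=.
have neq : [set s; t] != [set i; j].
  by apply: contraNneq iN => ->; rewrite set21.
rewrite /flip setU11 in_setU1 (negPf neq) setD11 /= setU1K ?setD1K ?eqxx //.
by rewrite in_setD1 (negPf flip_new) andbF.
Qed.

End Flip.

(** * Reduction to the fan at vertex 0 *)

Definition missing n (o : 'I_n) (C : {set {set 'I_n}}) : {set 'I_n} :=
  [set x : 'I_n | (o < x) && ([set o; x] \notin C)].

Lemma maximal_boundary n (C : {set {set 'I_n}}) (a b : 'I_n) :
  maximal_ws 2 C -> b = a.+1 :> nat -> [set a; b] \in C.
Proof.
case/maximal_ws2P => _ _ fillC eb; apply: fillC => [|x y _]; first by rewrite eb.
by rewrite /crosses eb ltnS ltnNge; case: (x <= a).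
Qed.

(** A chord avoiding 0 that is not a boundary edge crosses the fan chord from 0 to [a.+1]. So [C]
    has only fan chords and boundary edges, all of which lie in [B]. *)
Lemma fan_unique n (o : 'I_n) (C B : {set {set 'I_n}}) : o = 0 :> nat ->
  maximal_ws 2 C -> maximal_ws 2 B -> missing o C = set0 -> missing o B = set0 ->
  C = B.
Proof.
move=> o0 maxC maxB mC mB.
have fan D (x : 'I_n) : missing o D = set0 -> o < x -> [set o; x] \in D.
  move=> /setP/(_ x); rewrite !inE => e ox; move: e.
  by rewrite ox => /negbT; rewrite negbK.
have sub : C \subset B.
  apply/subsetP => I IC; have [cardC ncr _] := maximal_ws2P _ maxC.
  have /eqP/card2_ltP[a [b [lt_ab eI]]] := cardC I IC; subst I.
  have [a0|a_gt0] := posnP a.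
    have -> : a = o by apply: val_inj; rewrite /= a0 o0.
    by apply: fan => //; rewrite o0 -a0.
  have := lt_ab; rewrite leq_eqVlt => /orP[/eqP eb|lt_b].
    exact: maximal_boundary maxB (esym eb).
  have lt_n : a.+1 < n by apply: ltn_trans lt_b (ltn_ord b).
  have xoC : [set Ordinal lt_n; o] \in C by rewrite setUC fan ?o0.
  by case/negP: (ncr _ _ _ _ IC xoC); rewrite /crosses /= ltnSn lt_b o0 a_gt0.
by case/maxsetP: maxB => wsB _; case/maxsetP: maxC => _ /(_ B wsB sub).
Qed.

Lemma exists_square n (o : 'I_n) (C : {set {set 'I_n}}) : o = 0 :> nat ->
  maximal_ws 2 C -> missing o C != set0 ->
  exists a c b : 'I_n, [/\ [&& o < a, a < c & c < b],
    [set o; a] \in C, [set a; c] \in C, [set c; b] \in C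
    & [set o; b] \in C /\ [set a; b] \in C].
Proof.
move=> o0 maxC /set0Pn[m]; rewrite inE => /andP[o_m omC].
have [_ ncr fillC] := maximal_ws2P _ maxC.
have m0 : 0 < m by rewrite -o0.
have lt1 : 1 < n by apply: leq_ltn_trans (ltn_ord m).
have ltn1 : n.-1 < n by rewrite ltn_predL ltnW.
have le_n1 (x : 'I_n) : x <= n.-1 by rewrite -ltnS prednK // ltnW.
(* The edges from 0 to 1 and to [n.-1] guarantee neighbours of 0 on both sides of [m]. *)
have o1C : [set o; Ordinal lt1] \in C by apply: maximal_boundary; rewrite ?o0.
have onC : [set o; Ordinal ltn1] \in C.
  apply: fillC => [|x y _]; first by rewrite o0 (leq_trans m0).
  by rewrite /crosses o0 /= [n.-1 < y]ltnNge le_n1 !andbF.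
have neq_m (x : 'I_n) : [set o; x] \in C -> (x != m :> nat).
  by move=> oxC; apply: contraNneq omC => /val_inj <-.
pose P (x : 'I_n) := (0 < x < m) && ([set o; x] \in C).
pose Q (x : 'I_n) := (m < x) && ([set o; x] \in C).
have P1 : P (Ordinal lt1) by rewrite /P o1C andbT /= ltn_neqAle m0 (neq_m _ o1C).
have Qn : Q (Ordinal ltn1).
  by rewrite /Q onC andbT ltn_neqAle eq_sym (neq_m _ onC) le_n1.
case: (arg_maxnP (fun x : 'I_n => val x) P1) => a /andP[/andP[a0 am] oaC] maxa.
case: (arg_minnP (fun x : 'I_n => val x) Qn) => b /andP[mb obC] minb.
have lt_ab := ltn_trans am mb.
have gap (x : 'I_n) : a < x -> x < b -> [set o; x] \notin C.
  move=> ax xb; apply/negP => oxC; case: (ltngtP x m) (neq_m _ oxC) => // xm _.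
    have := maxa x; rewrite /P oxC xm (ltn_trans a0 ax) => /(_ isT) /=.
    by rewrite leqNgt ax.
  by have := minb x; rewrite /Q oxC xm => /(_ isT) /=; rewrite leqNgt xb.
(* A chord crossing [ab] from inside would end at 0, against [gap], or cross [oa] or [ob]. *)
have abC : [set a; b] \in C.
  apply: fillC => // x y xyC; have yxC : [set y; x] \in C by rewrite setUC.
  apply/negP => /and3P[ax xb out]; have [y0|y_gt0] := posnP y.
    have ey : y = o by apply: val_inj; rewrite /= y0 o0.
    by have := gap x ax xb; rewrite -ey yxC.
  case/orP: out => h.
    by case/negP: (ncr _ _ _ _ oaC yxC); rewrite /crosses o0 y_gt0 h ax orbT.
  case/negP: (ncr _ _ _ _ obC xyC).
  by rewrite /crosses o0 (ltn_trans a0 ax) xb h orbT.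
have lta1 : a.+1 < n by apply: leq_ltn_trans am (ltn_ord m).
pose S (x : 'I_n) := (a < x < b) && ([set a; x] \in C).
(* The boundary edge from [a] to [a.+1] makes the choice of [c] possible. *)
have S1 : S (Ordinal lta1).
  by rewrite /S (maximal_boundary maxC) //= andbT ltnSn (leq_ltn_trans am mb).
case: (arg_maxnP (fun x : 'I_n => val x) S1) => c /andP[/andP[ac cb] acC] maxc.
exists a, c, b; split; rewrite ?o0 ?a0 ?ac //.
(* A chord crossing [cb] cannot cross [ab] or [ac], so it ends at [a], against the choice of [c]. *)
apply: fillC => // x y xyC; have yxC : [set y; x] \in C by rewrite setUC.
apply/negP => /and3P[cx xb out]; have ax := ltn_trans ac cx.
have out_ab : ~ (y < a) || (b < y).
  by move=> h; case/negP: (ncr _ _ _ _ abC xyC); rewrite /crosses ax xb.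
case/orP: out => h; last by case: out_ab; rewrite h orbT.
case: (ltngtP y a) => [ya|ay|/val_inj ey]; first by case: out_ab; rewrite ya.
  by case/negP: (ncr _ _ _ _ acC yxC); rewrite /crosses ay h cx orbT.
by have := maxc x; rewrite /S ax xb -ey yxC => /(_ isT) /=; rewrite leqNgt cx.
Qed.

(** Induction on the number of missing neighbours; both directions are kept so that two paths can be
    joined at the fan. *)
Lemma connect_fan n (o : 'I_n) (C : {set {set 'I_n}}) : o = 0 :> nat ->
  maximal_ws 2 C ->
  exists F, [/\ maximal_ws 2 F, missing o F = set0,
                connect (@move24 n 2) C F & connect (@move24 n 2) F C].
Proof.
move=> o0; have [k] := ubnP #|missing o C|; elim: k C => // k IHk C ltk maxC.
have [m0|mN0] := eqVneq (missing o C) set0; first by exists C.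
have [a [c [b [/and3P[oa ac cb] oaC acC cbC [obC abC]]]]] :=
  exists_square o0 maxC mN0.
have ocN := flip_new oa ac cb maxC abC.
have [||F [maxF mF toF fromF]] := IHk (flip C o a c b).
(* The flip adds [oc] and removes [ab], which does not contain 0, so [c] leaves the missing set and
   nothing enters it. *)
- rewrite ltnS in ltk; apply: leq_trans ltk; apply: proper_card.
  apply/properP; split.
    apply/subsetP => x; rewrite inE => /andP[ox oxN]; rewrite inE ox /=.
    apply: contraNN oxN.
    apply: pair_sub_flip; rewrite !inE -!val_eqE /=.
    by rewrite (ltn_eqF oa) (ltn_eqF (ltn_trans oa (ltn_trans ac cb))).
  by exists c; rewrite !inE ?eqxx ?andbF // ocN (ltn_trans oa ac).
- exact: maximal_flip.
exists F; split=> //.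
  by apply: connect_trans toF; apply/connect1/move24_flip.
by apply: connect_trans fromF _; apply/connect1/move24_unflip.
Qed.

Theorem theorem4 (n : nat) (hn : 2 <= n) (C B : {set {set 'I_n}})
    (hC : maximal_ws 2 C) (hB : maximal_ws 2 B) :
  exists2 p : seq {set {set 'I_n}}, path (@move24 n 2) C p & last C p = B.
Proof.
have o0 : Ordinal (ltnW hn) = 0 :> nat by [].
have [F [maxF mF CF _]] := connect_fan o0 hC.
have [G [maxG mG _ GB]] := connect_fan o0 hB.
rewrite (fan_unique o0 maxG maxF mG mF) in GB.
by have /connectP[p pathp lastp] := connect_trans CF GB; exists p.
Qed.
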